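(* Let $X$ be a finite set with $|X|=n\ge 1$. Then the graded poset $\operatorname{Bip}(X)$ of bipartitional relations on $X$, ordered by inclusion, has rank $3n-2$.
   Context: A relation $U\subseteq X\times X$ on a finite set $X$ is bipartitional if both $U$ and $(X\times X)\setminus U$ are transitive. $\operatorname{Bip}(X)$ is the set of bipartitional relations on $X$, partially ordered by inclusion; its minimum is $\emptyset$ and its maximum is $X\times X$. The rank of a graded poset with minimum and maximum is the length (number of cover relations) of any maximal chain. *)

(* Defs.v *)
From HB Require Import structures.
From mathcomp Require Import all_boot all_order.

Set Implicit Arguments.
Unset Strict Implicit.
Unset Printing Implicit Defensive.

Import Order.TTheory.

Section GradedPosets.

Variables (d : Order.disp_t) (P : finPOrderType d).

Definition covered_by (x y : P) : bool :=
  (x < y)%O && ~~ [exists z, (x < z < y)%O].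

Definition chain (C : {set P}) : bool :=
  [forall x in C, forall y in C, (x >=< y)%O].

Definition maximal_chain (C : {set P}) : bool := maxset chain C.

(* The number of cover relations of P between elements of C. *)
Definition chain_length (C : {set P}) : nat :=
  #|[set xy in setX C C | covered_by xy.1 xy.2]|.

Definition graded : Prop :=
  forall C D : {set P}, maximal_chain C -> maximal_chain D ->
    chain_length C = chain_length D.

Lemma maximal_chain_exists : exists C : {set P}, maximal_chain C.
Proof.
have chain0 : chain set0 by apply/forall_inP => x; rewrite inE.
by have [C maxC _] := maxset_exists chain0; exists C.
Qed.

(* The length of a chosen maximal chain; by rank_graded the choice is
   irrelevant when P is graded, the only case in which this is meaningful. *)
Definition rank : nat := chain_length (xchoose maximal_chain_exists).

Lemma rank_graded (C : {set P}) :
  graded -> maximal_chain C -> rank = chain_length C.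
Proof. by move=> gradedP maxC; apply: gradedP (xchooseP _) maxC. Qed.

End GradedPosets.

Arguments graded {d} P.
Arguments rank {d} P.

Section Bipartitional.

Variable X : finType.

Definition transitive_set (U : {set X * X}) : bool :=
  [forall y, forall x, forall z,
     ((x, y) \in U) ==> (((y, z) \in U) ==> ((x, z) \in U))].

Lemma transitive_setP (U : {set X * X}) :
  reflect (transitive [rel x y | (x, y) \in U]) (transitive_set U).
Proof.
apply: (iffP forallP) => [trU y x z /= | trU y].
  by move/forallP/(_ x)/forallP/(_ z): (trU y) => /implyP H /H /implyP.
by apply/forallP => x; apply/forallP => z; apply/implyP => xy; apply/implyP;
  apply: trU xy.
Qed.

Definition bipartitional (U : {set X * X}) : bool :=
  transitive_set U && transitive_set (~: U).

Lemma bipartitionalP (U : {set X * X}) :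
  reflect (transitive [rel x y | (x, y) \in U] /\
           transitive [rel x y | (x, y) \notin U])
          (bipartitional U).
Proof.
have trC : transitive [rel x y | (x, y) \in ~: U] <->
           transitive [rel x y | (x, y) \notin U].
  by split=> tr y x z; move: (tr y x z); rewrite /= !inE.
apply: (iffP andP) => [[/transitive_setP trU /transitive_setP /trC trUC] //|].
by move=> [trU /trC trUC]; split; apply/transitive_setP.
Qed.

Record Bip := MkBip { bip_set :> {set X * X}; _ : bipartitional bip_set }.

HB.instance Definition _ := [isSub for bip_set].
HB.instance Definition _ := [Finite of Bip by <:].

Fact bip_display : Order.disp_t. Proof. exact: Order.Disp tt tt. Qed.

Definition bip_le (U V : Bip) : bool := U \subset V.

Fact bip_le_refl : reflexive bip_le.
Proof. by move=> U; apply: subxx. Qed.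

Fact bip_le_anti : antisymmetric bip_le.
Proof. by move=> U V UV; apply/val_inj/eqP; rewrite eqEsubset. Qed.

Fact bip_le_trans : transitive bip_le.
Proof. by move=> U V W; apply: subset_trans. Qed.

HB.instance Definition _ :=
  Order.Le_isPOrder.Build bip_display Bip
    bip_le_refl bip_le_anti bip_le_trans.

Lemma leEbip (U V : Bip) : (U <= V)%O = (bip_set U \subset bip_set V).
Proof. by []. Qed.

Fact bipartitional0 : bipartitional set0.
Proof. by apply/bipartitionalP; split=> y x z /=; rewrite !inE. Qed.

Fact bipartitionalT : bipartitional setT.
Proof. by apply/bipartitionalP; split=> y x z /=; rewrite !inE. Qed.

Fact bip_le0 (U : Bip) : (MkBip bipartitional0 <= U)%O.
Proof. exact: sub0set. Qed.

Fact bip_leT (U : Bip) : (U <= MkBip bipartitionalT)%O.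
Proof. exact: subsetT. Qed.

HB.instance Definition _ := Order.hasBottom.Build bip_display Bip bip_le0.
HB.instance Definition _ := Order.hasTop.Build bip_display Bip bip_leT.

End Bipartitional.

(* Main.v *)
(* A bipartitional relation is an ordered partition of X some of whose blocks
   are underlined: (x, y) belongs to it when the block of x precedes that of y,
   or when both lie in the same underlined block. If U is strictly below V, one
   of three moves leads from U to a relation still below V: splitting a plain
   block, underlining a plain singleton, or merging two adjacent underlined
   blocks. Each move increases
     #(plain blocks) + 3 * #(elements in underlined blocks)
       - #(underlined blocks)
   by one, so all covers are such moves and this quantity is a rank function;
   it goes from 1 at the empty relation to 3n - 1 at the full one. *)
Require Import Defs.
From HB Require Import structures.
From mathcomp Require Import all_boot all_order.
From mathcomp Require Import zify.

Set Implicit Arguments.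
Unset Strict Implicit.
Unset Printing Implicit Defensive.

Import Order.TTheory.

(** * Maximal chains and rank functions on finite bounded posets *)

Lemma maximal_chain_mem {d : Order.disp_t} {P : finPOrderType d}
    (C : {set P}) (z : P) :
  maximal_chain C -> {in C, forall x, (x >=< z)%O} -> z \in C.
Proof.
move=> /maxsetP[chC maxC] Cz; suff <- : z |: C = C by rewrite setU11.
apply: maxC (subsetUr _ _); apply/forall_inP=> x /setU1P xC.
apply/forall_inP=> y /setU1P yC.
case: xC yC => [->|xC] [->|yC]; first exact: comparablexx.
- by rewrite comparable_sym Cz.
- exact: Cz.
- by move/forall_inP/(_ x xC)/forall_inP/(_ y yC): chC.
Qed.

Section RankFunction.

Variables (d : Order.disp_t) (P : finTBPOrderType d) (r : P -> nat).

Hypothesis step : forall x y : P,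
  (x < y)%O -> exists z : P, [/\ (x < z)%O, (z <= y)%O & r z = (r x).+1].

(** Induction on the number of elements above [x]: the intermediate [z] has fewer, since it is not
    above itself. *)
Lemma rank_function_lt (x y : P) : (x < y)%O -> r x < r y.
Proof.
have [k] := ubnP #|[set w : P | (x < w)%O]|; elim: k x => // k IHk x lek ltxy.
have [z [ltxz lezy rz]] := step ltxy; move: lezy; rewrite le_eqVlt.
case/predU1P=> [<-|ltzy]; first by rewrite rz.
suff /IHk/(_ ltzy) : #|[set w : P | (z < w)%O]| < k by rewrite rz; exact: ltnW.
rewrite -ltnS; apply: leq_trans lek; apply: proper_card.
apply/properP; split; first by apply/subsetP=> w; rewrite !inE; apply: lt_trans.
by exists z; rewrite !inE ?ltxx.
Qed.

Lemma rank_function_covered (x y : P) : covered_by x y -> r y = (r x).+1.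
Proof.
case/andP=> /step[z [ltxz]]; rewrite le_eqVlt.
case/predU1P=> [-> //|ltzy _ /existsP[]]; by exists z; rewrite ltxz.
Qed.

Variable C : {set P}.
Hypothesis maxC : maximal_chain C.

Lemma maximal_chain_comparable (x y : P) :
  x \in C -> y \in C -> (x >=< y)%O.
Proof.
have /maxsetP[chC _] := maxC => xC yC.
by move/forall_inP/(_ x xC)/forall_inP/(_ y yC): chC.
Qed.

(** Take the element [x] of [C] below [y] with the largest [r]. Anything strictly between them is
    comparable to all of [C], hence lies in [C] and contradicts the choice of [x]. *)
Lemma maximal_chain_pred (y : P) :
  y \in C -> y != \bot%O -> exists2 x, x \in C & covered_by x y.
Proof.
move=> yC yN0.
have botC : \bot%O \in C.
  apply: maximal_chain_mem => // x _.
  by rewrite comparable_sym le_comparable ?le0x.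
have: (\bot%O \in C) && (\bot%O < y :> P)%O by rewrite botC lt0x.
case/(@arg_maxnP _ _ (fun x => (x \in C) && (x < y)%O) r) => x.
case/andP=> xC ltxy maxx; exists x => //; rewrite /covered_by ltxy.
apply/existsP=> -[z /andP[ltxz ltzy]].
suff zC : z \in C.
  by have /= := maxx z; rewrite zC ltzy /geq /= leqNgt rank_function_lt // => /(_ isT).
apply: maximal_chain_mem => // w wC.
have [leyw|Nleyw] := boolP (y <= w)%O.
  by rewrite comparable_sym le_comparable // ltW ?(lt_le_trans ltzy).
have ltwy : (w < y)%O.
  by have := maximal_chain_comparable wC yC; case: comparableP Nleyw.
suff lewx : (w <= x)%O by rewrite le_comparable // ltW ?(le_lt_trans lewx).
have := maximal_chain_comparable wC xC; case: comparableP => // ltxw _.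
by have /= := maxx w; rewrite wC ltwy /geq /= leqNgt rank_function_lt // => /(_ isT).
Qed.

Lemma covered_by_injr (x y z : P) :
  y \in C -> z \in C -> covered_by x y -> covered_by x z -> y = z.
Proof.
move=> yC zC /andP[ltxy Ny] /andP[ltxz Nz].
have := maximal_chain_comparable yC zC; case: comparableP => // lt _.
  by case/existsP: Nz; exists y; rewrite ltxy.
by case/existsP: Ny; exists z; rewrite ltxz.
Qed.

(** Sending a cover to the [r]-value of its lower end is a bijection from the covers in [C] onto the
    integers from [r \bot] up to, but excluding, [r \top]. *)
Lemma chain_length_rank_function : chain_length C = r \top%O - r \bot%O.
Proof.
set E := [set xy in setX C C | covered_by xy.1 xy.2].
rewrite /chain_length -/E cardE -(size_map (fun xy => r xy.1)).
rewrite -(size_iota (r \bot%O) (r \top%O - r \bot%O)).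
have ler0 (x : P) : r \bot%O <= r x.
  have := le0x x; rewrite le_eqVlt
    => /predU1P[-> //|/rank_function_lt]; exact: ltnW.
have ler1 (x : P) : r x <= r \top%O.
  have := lex1 x; rewrite le_eqVlt
    => /predU1P[-> //|/rank_function_lt]; exact: ltnW.
apply/perm_size/uniq_perm; rewrite ?iota_uniq //.
  rewrite map_inj_in_uniq ?enum_uniq // => -[x y] [x' y'].
  rewrite !mem_enum !inE /= => /andP[/andP[xC yC] cxy] /andP[/andP[x'C y'C] cxy'].
  move=> eqr; have exx' : x = x'.
    have := maximal_chain_comparable xC x'C.
    by case: comparableP => // /rank_function_lt; rewrite eqr ltnn.
  by rewrite -exx' in cxy' *; rewrite (covered_by_injr yC y'C cxy cxy').
move=> k; rewrite mem_iota subnKC ?ler0 //; apply/mapP/andP => [[[x y]]|[]].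
  rewrite mem_enum !inE /= => /andP[_ /andP[/rank_function_lt ltxy _]] ->.
  by split=> //; apply: leq_trans ltxy _.
have topC : \top%O \in C.
  by apply: maximal_chain_mem => // x _; rewrite le_comparable ?lex1.
(* Surjectivity: descend from the top by covers inside [C]; [r] drops by one each time, so [k] is
   reached. *)
move=> le0k; have [m] := ubnP (r \top%O); move: (\top%O) topC.
elim: m => // m IHm y yC ltm ltk.
have yN0 : y != \bot%O by apply: contraTneq ltk => ->; rewrite -leqNgt.
have [x xC cxy] := maximal_chain_pred yC yN0.
have ry := rank_function_covered cxy.
have [->|neqk] := eqVneq k (r x).
  by exists (x, y); rewrite ?mem_enum ?inE ?xC ?yC.
by apply: IHm xC _ _; lia.
Qed.

End RankFunction.

Lemma graded_rank_function {d : Order.disp_t} (P : finTBPOrderType d)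
    (r : P -> nat) :
  (forall x y : P, (x < y)%O ->
     exists z : P, [/\ (x < z)%O, (z <= y)%O & r z = (r x).+1]) ->
  graded P /\ rank P = r \top%O - r \bot%O.
Proof.
move=> step; have len C := @chain_length_rank_function _ P r step C.
split=> [C D maxC maxD|]; first by rewrite !len.
exact/len/xchooseP.
Qed.

(** * Bipartitional relations through their rows, the sets of successors *)

Section Rows.

Variable X : finType.
Implicit Types (U V : {set X * X}) (A B C D R : {set X}) (x y z : X).

Lemma setU_subD A B : A \subset B -> A :|: (B :\: A) = B.
Proof. by move=> AB; rewrite -{1}(setIidPr AB) setID. Qed.

Definition succs U x : {set X} := [set y | (x, y) \in U].

(** Transitivity of [U] gives the first inclusion, transitivity of the complement the second by
    contraposition. In particular the rows form a chain under inclusion. *)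
Lemma bipartitional_succsP U :
  reflect (forall x y, if y \in succs U x then succs U y \subset succs U x
                       else succs U x \subset succs U y)
          (bipartitional U).
Proof.
apply: (iffP (bipartitionalP U)) => [[trU trC] x y|rowU].
  rewrite inE; case: ifPn => xy; apply/subsetP=> z; rewrite !inE.
    exact: trU xy.
  by apply: contraLR => /(trC _ _ _ xy).
split=> y x z /=; have := rowU x y; rewrite !inE.
  by move=> + xy; rewrite xy => /subsetP/(_ z); rewrite !inE.
by move=> + Nxy; rewrite (negPf Nxy) => /subsetP/(_ z)/contra; rewrite !inE; apply.
Qed.

Lemma succs_sub {U x y} :
  bipartitional U -> y \in succs U x -> succs U y \subset succs U x.
Proof. by move=> /bipartitional_succsP/(_ x y); case: ifP. Qed.

Lemma succs_sup {U x y} :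
  bipartitional U -> y \notin succs U x -> succs U x \subset succs U y.
Proof. by move=> /bipartitional_succsP/(_ x y); case: ifP. Qed.

Lemma subset_succs {U V} x : U \subset V -> succs U x \subset succs V x.
Proof. by move=> /subsetP UV; apply/subsetP=> y; rewrite !inE; apply: UV. Qed.

Definition reflexives U : {set X} := [set x | (x, x) \in U].

(* Elements of one block have the same successors, and two blocks of the same
   kind have distinct sets of successors: the sets of successors count the
   plain and the underlined blocks. A plain block immediately before an
   underlined one has the same successors, so one must count separately. *)
Definition plain_rows U : {set {set X}} := succs U @: ~: reflexives U.
Definition underlined_rows U : {set {set X}} := succs U @: reflexives U.

Definition bip_rank U : nat :=
  #|plain_rows U| + 3 * #|reflexives U| - #|underlined_rows U|.

(** Ensures that the natural-number subtraction in [bip_rank] is never truncated. *)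
Lemma leq_card_underlined_rows U : #|underlined_rows U| <= #|reflexives U|.
Proof. exact: leq_imset_card. Qed.

Lemma mem_succs_refl U x : (x \in succs U x) = (x \in reflexives U).
Proof. by rewrite !inE. Qed.

Lemma succs_setUX U C D x :
  succs (U :|: setX C D) x = if x \in C then succs U x :|: D else succs U x.
Proof.
by apply/setP=> y; case: ifP => xC; rewrite !inE /= xC ?orbF.
Qed.

(** The common row [R] of [C] grows to [R :|: D]. The last three hypotheses supply what the row
    criterion for [U] does not already give for pairs with exactly one element in [C]. *)
Lemma bipartitional_setUX U C D R :
    bipartitional U -> {in C, forall x, succs U x = R} ->
    {in D, forall y, succs U y \subset R :|: D} ->
    (forall y, y \notin C -> y \notin R :|: D -> D \subset succs U y) ->
    (forall x c, x \notin C -> c \in C -> c \in succs U x -> D \subset succs U x) ->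
  bipartitional (U :|: setX C D).
Proof.
move=> bU rowC subD outD inD; apply/bipartitional_succsP=> x y.
rewrite !succs_setUX.
case: (boolP (x \in C)) (boolP (y \in C)) => [] xC [] yC.
- by rewrite !rowC // subxx; case: ifP.
- rewrite rowC //; case: ifPn => [/setUP[yR|/subD //]|yRD].
    by rewrite subsetU // -(rowC x xC) succs_sub // rowC.
  rewrite subUset outD // -(rowC x xC) succs_sup ?rowC //.
  by apply: contra yRD => yR; rewrite inE yR.
- case: ifPn => xy; first by rewrite subUset succs_sub // (inD x y).
  by rewrite subsetU // succs_sup.
- by move: (bipartitional_succsP _ bU x y).
Qed.

(** * Moves on a plain block: splitting and underlining *)

Section PlainBlock.

Variables (U : {set X * X}) (x0 : X).
Hypotheses (bU : bipartitional U) (x0N : x0 \notin succs U x0).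

(** The second condition excludes an underlined block that immediately follows and has the same
    row. *)
Definition plain_block : {set X} :=
  [set z | (succs U z == succs U x0) && (z \notin succs U x0)].

Lemma plain_blockP z :
  reflect (succs U z = succs U x0 /\ z \notin succs U x0) (z \in plain_block).
Proof. by rewrite [_ \in plain_block]in_set; apply: (iffP andP) => -[/eqP]. Qed.

(** [C] and [D] may overlap: complementary parts split the block, and [C = D] equal to the whole
    block underlines it. *)
Lemma bipartitional_split C D :
  C :|: D = plain_block -> bipartitional (U :|: setX C D).
Proof.
move=> CD; have CB z : z \in C -> z \in plain_block by rewrite -CD inE => ->.
have DB z : z \in D -> z \in plain_block by rewrite -CD inE orbC => ->.
apply: (@bipartitional_setUX U C D (succs U x0)) => //.
- by move=> z /CB/plain_blockP[].
- by move=> z /DB/plain_blockP[-> _]; apply: subsetUl.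
- move=> y yC; rewrite inE negb_or => /andP[yR yD].
  apply/subsetP=> z /DB/plain_blockP[zR zN].
  apply/negPn/negP => /(succs_sup bU); rewrite zR => subR.
  suff: y \in C :|: D by rewrite inE (negPf yC) (negPf yD).
  rewrite CD; apply/plain_blockP; split=> //; apply/eqP.
  by rewrite eqEsubset subR (succs_sup bU).
- move=> x c xC /CB/plain_blockP[cR cN] cx.
  apply/subsetP=> z /DB/plain_blockP[zR zN].
  apply/negPn/negP => /(succs_sup bU); rewrite zR => /subsetP/(_ c cx).
  by rewrite (negPf cN).
Qed.

(** Exactly one plain row is new, that of [C]; the old row survives on the rest of the block,
    witnessed by [e]. *)
Lemma bip_rank_split C :
    C != set0 -> C \proper plain_block ->
  bip_rank (U :|: setX C (plain_block :\: C)) = (bip_rank U).+1.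
Proof.
move=> /set0Pn[c cC] /properP[/subsetP CB [e eB eC]].
set D := plain_block :\: C; set W := U :|: setX C D.
have DE z : (z \in D) = (z \notin C) && (z \in plain_block) by rewrite inE.
have eD : e \in D by rewrite DE eC.
have reflW : reflexives W = reflexives U.
  by apply/setP=> z; rewrite !inE /=; case: (z \in C); rewrite ?andbF ?orbF.
have plainNrefl z : z \in plain_block -> z \notin reflexives U.
  by rewrite -mem_succs_refl => /plain_blockP[->].
have undW : underlined_rows W = underlined_rows U.
  rewrite /underlined_rows reflW; apply: eq_in_imset => z zr.
  by rewrite succs_setUX; case: ifP => // /CB/plainNrefl; rewrite zr.
have plW : plain_rows W = (succs U x0 :|: D) |: plain_rows U.
  rewrite /plain_rows reflW; apply/setP=> S; apply/imsetP/setU1P.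
    case=> z zr ->; rewrite succs_setUX; case: ifP => [/CB/plain_blockP[-> _]|_].
      by left.
    by right; apply: imset_f.
  case=> [->|/imsetP[z zr ->]].
    exists c; first by rewrite inE plainNrefl // CB.
    by rewrite succs_setUX cC; have /CB/plain_blockP[->] := cC.
  case zC: (z \in C); last by exists z; rewrite // succs_setUX zC.
  exists e; first by rewrite inE plainNrefl.
  rewrite succs_setUX (negPf eC).
  by have /CB/plain_blockP[-> _] := zC; have /plain_blockP[-> _] := eB.
(* An element [z] with this row would not have [c] as a successor, so its row would lie in that of
   [c], which misses [e]. *)
have newD : succs U x0 :|: D \notin plain_rows U.
  apply/imsetP=> -[z _ rz]; have /plain_blockP[cR cN] := CB _ cC.
  have: c \notin succs U z by rewrite -rz in_setU negb_or cN DE cC.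
  move/(succs_sup bU); rewrite -rz cR => /subsetP/(_ e).
  by rewrite in_setU eD orbT; have /plain_blockP[_ /negPf->] := eB => /(_ isT).
rewrite /bip_rank reflW undW plW cardsU1 newD.
by have := leq_card_underlined_rows U; lia.
Qed.

(** One plain row is lost, one reflexive element and one underlined row are gained: -1 + 3 - 1 =
    1. *)
Lemma bip_rank_underline :
  plain_block = [set x0] -> bip_rank (U :|: setX [set x0] [set x0]) = (bip_rank U).+1.
Proof.
move=> B1; set W := U :|: _.
have x0r : x0 \notin reflexives U by rewrite -mem_succs_refl.
have reflW : reflexives W = x0 |: reflexives U.
  by apply/setP=> z; rewrite !inE /= !andbb orbC.
have rowW z : z != x0 -> succs W z = succs U z.
  by rewrite succs_setUX inE => /negPf->.
have rowWx0 : succs W x0 = x0 |: succs U x0.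
  by rewrite succs_setUX set11 setUC.
have undW : underlined_rows W = (x0 |: succs U x0) |: underlined_rows U.
  rewrite /underlined_rows reflW imsetU1 rowWx0; congr (_ |: _).
  by apply: eq_in_imset => z zr; apply: rowW; apply: contraNneq x0r => <-.
have newU : x0 |: succs U x0 \notin underlined_rows U.
  apply/imsetP=> -[z]; rewrite -mem_succs_refl => zz rz.
  move: (zz); rewrite -rz => /setU1P[ez|/(succs_sub bU)].
    by move: zz x0N; rewrite ez => ->.
  by rewrite -rz => /subsetP/(_ x0); rewrite setU11 (negPf x0N) => /(_ isT).
have plU : plain_rows U = succs U x0 |: plain_rows W.
  have -> : plain_rows W = succs U @: (~: (x0 |: reflexives U)).
    rewrite /plain_rows reflW; apply: eq_in_imset => z.
    by rewrite !inE negb_or => /andP[/rowW].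
  rewrite /plain_rows -imsetU1.
  suff -> : ~: reflexives U = x0 |: ~: (x0 |: reflexives U) by [].
  apply/setP=> z; rewrite in_setU1 !in_setC in_setU1.
  by have [->|] := eqVneq z x0.
have newW : succs U x0 \notin plain_rows W.
  apply/imsetP=> -[z]; rewrite inE reflW inE negb_or inE => /andP[zx0 zr].
  rewrite rowW // => rz; case/negP: zx0; rewrite -in_set1 -B1.
  by apply/plain_blockP; rewrite rz mem_succs_refl.
rewrite /bip_rank reflW undW plU !cardsU1 newU newW x0r.
by have := leq_card_underlined_rows U; lia.
Qed.

End PlainBlock.

(** * Merging two adjacent underlined blocks *)

Section Merge.

Variables (U : {set X * X}) (x y : X).
Hypotheses (bU : bipartitional U) (xx : x \in succs U x) (yy : y \in succs U y).
Hypothesis ltxy : succs U x \proper succs U y.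
Hypothesis adjacent :
  forall w, w \in succs U y -> w \notin succs U x -> succs U w = succs U y.

Definition underlined_block : {set X} :=
  [set z in reflexives U | succs U z == succs U x].

(** The block of [y] immediately precedes that of [x] and equals [succs U y :\: succs U x]; making
    it a successor of the block of [x] gives both blocks the row of [y]. *)
Definition merge : {set X * X} :=
  U :|: setX underlined_block (succs U y :\: succs U x).

Lemma succs_merge z :
  succs merge z = if z \in underlined_block then succs U y else succs U z.
Proof.
rewrite succs_setUX; case: ifP => //; rewrite inE => /andP[_ /eqP->].
by rewrite setU_subD ?proper_sub.
Qed.

Lemma bipartitional_merge : bipartitional merge.
Proof.
have RD : succs U x :|: (succs U y :\: succs U x) = succs U y.
  by rewrite setU_subD ?proper_sub.
apply: (@bipartitional_setUX U _ _ (succs U x)); rewrite ?RD //.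
- by move=> z; rewrite inE => /andP[_ /eqP].
- by move=> z; rewrite inE => /andP[zx zy]; rewrite adjacent.
- by move=> z _ zy; rewrite subDset subsetU // (succs_sup bU zy) orbT.
- move=> z c zC; rewrite inE => /andP[_ /eqP cR] cz.
  have subz : succs U x \subset succs U z by rewrite -cR (succs_sub bU).
  rewrite subDset subsetU //; apply/orP; right.
  (* Outside the row of [y], [z] has a row containing it; in the difference, adjacency applies;
     inside the row of [x], [z] would lie in the block of [x]. *)
  have [zy|zy] := boolP (z \in succs U y); last exact: succs_sup.
  have [zx|zx] := boolP (z \in succs U x); last by rewrite (adjacent zy zx).
  case/negP: zC; rewrite inE -mem_succs_refl (subsetP subz) //=.
  by rewrite eqEsubset subz (succs_sub bU).
Qed.

(** Only the underlined row of [x] disappears: every reflexive element having it takes the row of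
    [y]. *)
Lemma bip_rank_merge : bip_rank merge = (bip_rank U).+1.
Proof.
have subC z : z \in underlined_block -> succs U z = succs U x.
  by rewrite inE => /andP[_ /eqP].
have reflW : reflexives merge = reflexives U.
  apply/setP=> z; rewrite -!mem_succs_refl succs_merge; case: ifP => //.
  move=> zC; move: (zC); rewrite in_set -mem_succs_refl => /andP[zz _]; rewrite zz.
  by apply: (subsetP (proper_sub ltxy)); rewrite -(subC z zC).
have plW : plain_rows merge = plain_rows U.
  rewrite /plain_rows reflW; apply: eq_in_imset => z.
  rewrite in_setC succs_merge => zN.
  by case: ifP => //; rewrite in_set (negPf zN).
have neqxy : succs U y != succs U x.
  by apply: contraTneq ltxy => ->; rewrite properxx.
have undU : underlined_rows U = succs U x |: underlined_rows merge.
  rewrite /underlined_rows reflW; apply/setP=> S; apply/imsetP/setU1P.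
    case=> z zr ->; have [ez|nz] := eqVneq (succs U z) (succs U x); first by left.
    right; apply/imsetP; exists z => //.
    by rewrite succs_merge in_set (negPf nz) andbF.
  case=> [->|/imsetP[z zr ->]]; first by exists x; rewrite // -mem_succs_refl.
  rewrite succs_merge; case: ifP => _; last by exists z.
  by exists y; rewrite // -mem_succs_refl.
have newU : succs U x \notin underlined_rows merge.
  apply/imsetP=> -[z]; rewrite reflW succs_merge => zr.
  rewrite in_set zr /=; case: ifPn => [_ /esym/eqP|/eqP nz /esym //].
  by rewrite (negPf neqxy).
have := leq_card_underlined_rows U.
by rewrite /bip_rank reflW plW undU cardsU1 newU; lia.
Qed.

End Merge.

(** * Existence of a move that stays below a larger relation *)

(** If the plain block is a singleton, [V] allows underlining it. Otherwise it is split into [C] and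
    its complement so that [V] contains all pairs from the former to the latter. *)
Lemma bip_step_plain U V x y :
    bipartitional U -> bipartitional V -> U \subset V ->
    x \notin succs U x -> y \in plain_block U x -> (x, y) \in V ->
  exists W, [/\ bipartitional W, U \subset W, W \subset V
              & bip_rank W = (bip_rank U).+1].
Proof.
move=> bU bV UV xN yB xyV; set B := plain_block U x.
have xB : x \in B by apply/plain_blockP.
have [B1|BN1] := eqVneq B [set x].
  exists (U :|: setX [set x] [set x]); split.
  - by apply: (@bipartitional_split U x); rewrite ?setUid.
  - exact: subsetUl.
  - move: yB; rewrite -/B B1 inE => /eqP eyx; rewrite eyx in xyV.
    by rewrite subUset UV; apply/subsetP=> -[u v] /setXP[/set1P-> /set1P->].
  - exact: bip_rank_underline.
suff [C [CN0 CB CV]] : exists C, [/\ C != set0, C \proper B &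
    {in C & B :\: C, forall z w, (z, w) \in V}].
  exists (U :|: setX C (B :\: C)); split.
  - apply: (@bipartitional_split U x) => //.
    by rewrite setU_subD ?proper_sub.
  - exact: subsetUl.
  - rewrite subUset UV; apply/subsetP=> -[u v] /setXP[uC vD]; exact: CV.
  - exact: bip_rank_split.
(* If [x = y], then [x] is reflexive in [V], so any other [c] in the block is related to [x] by [V]
   in at least one direction. *)
have [b [e [bB eB neq_be beV]]] :
    exists b e, [/\ b \in B, e \in B, b != e & (b, e) \in V].
  have [eyx|nyx] := eqVneq x y; last by exists x, y.
  rewrite -eyx in xyV.
  have [c cB ncx] : exists2 c, c \in B & c != x.
    apply/exists_inP; apply: contraNT BN1; rewrite negb_exists_in => /forall_inP Bx.
    rewrite eqEsubset sub1set xB andbT; apply/subsetP=> z /Bx.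
    by rewrite negbK inE.
  have [xcV|xcNV] := boolP (c \in succs V x).
    by exists x, c; rewrite eq_sym; split; rewrite // inE in xcV *.
  exists c, x; split=> //; have /subsetP/(_ x) := succs_sup bV xcNV.
  by rewrite !inE; apply.
(* The V-predecessors of e in B form an initial segment of B for V; if this
   is all of B, then e itself is in the last V-block and can be split off. *)
have [/forall_inP allB|] := boolP [forall z in B, (z, e) \in V].
  exists (B :\ e); split.
  - by apply/set0Pn; exists b; rewrite in_setD1 neq_be.
  - exact: properD1.
  - move=> z w /setD1P[_ zB]; rewrite inE in_setD1 negb_and negbK => /andP[+ wB].
    by rewrite wB orbF => /eqP->; apply: allB.
rewrite negb_forall_in => /exists_inP[z zB zeV].
exists [set w in B | (w, e) \in V]; split.
- by apply/set0Pn; exists b; rewrite in_set bB.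
- apply/properP; split; first by apply/subsetP=> w; rewrite in_set => /andP[].
  by exists z; rewrite // in_set zB.
- move=> w v; rewrite in_set => /andP[wB weV].
  rewrite inE in_set negb_and => /andP[+ vB]; rewrite vB /=.
  apply: contraNT => wvN.
  have wvN' : v \notin succs V w by rewrite inE.
  by have /subsetP/(_ e) := succs_sup bV wvN'; rewrite !inE; apply.
Qed.

(** When [V] adds no pair inside a plain block, each new pair joins two underlined blocks of [U]
    that lie in one block of [V]; two adjacent ones among these can be merged. *)
Lemma bip_step_underlined U V :
    bipartitional U -> bipartitional V -> U \proper V ->
    (forall x y, x \notin succs U x -> y \in plain_block U x -> (x, y) \notin V) ->
  exists W, [/\ bipartitional W, U \subset W, W \subset V
              & bip_rank W = (bip_rank U).+1].
Proof.
move=> bU bV /properP[UV [[x y0] xyV xyU]] plainV.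
have newP y : y \in succs V x -> y \notin succs U x ->
    [/\ x \in succs U y, x \in succs U x, y \in succs U y & succs V y = succs V x].
  move=> yV yU.
  have reflU z : z \in succs V z -> z \in succs U z.
    move=> zV; apply/negPn/negP => zN.
    have zB : z \in plain_block U z by apply/plain_blockP.
    by have := plainV z z zN zB; move: zV; rewrite !inE => ->.
  (* Otherwise [x] and [y] have equal rows and share a plain block, where [V] adds nothing. *)
  have xy : x \in succs U y.
    apply/negPn/negP => xNy.
    have exy : succs U x = succs U y.
      by apply/eqP; rewrite eqEsubset !(succs_sup bU).
    have := plainV x y; rewrite exy xNy => /(_ isT).
    have -> : y \in plain_block U x by apply/plain_blockP.
    by move: yV; rewrite !inE => -> /(_ isT).
  have eV : succs V y = succs V x.
    apply/eqP; rewrite eqEsubset (succs_sub bV yV) (succs_sub bV) //.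
    exact: (subsetP (subset_succs y UV)).
  split=> //; apply: reflU; last by rewrite eV.
  by rewrite -eV (subsetP (subset_succs y UV)).
have: y0 \in succs V x :\: succs U x by rewrite !inE xyU.
(* The smallest such [succs U y] makes the block of y adjacent to that of x. *)
case/(@arg_minnP _ _ _ (fun y => #|succs U y|)) => y /setDP[yV yU] miny.
have [xy xx yy eV] := newP y yV yU.
have adj w : w \in succs U y -> w \notin succs U x -> succs U w = succs U y.
  move=> wy wx; apply/eqP; rewrite eqEcard (succs_sub bU wy).
  apply: miny; apply/setDP; split=> //.
  by rewrite -eV (subsetP (subset_succs y UV)).
have ltxy : succs U x \proper succs U y.
  by apply/properP; split; [apply: succs_sub | exists y].
exists (merge U x y); split.
- exact: bipartitional_merge.
- exact: subsetUl.
(* The merge stays below [V] because [x] and [y] have the same row in [V]. *)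
- rewrite subUset UV; apply/subsetP=> -[u v] /setXP[].
  rewrite in_set -mem_succs_refl => /andP[_ /eqP eu] /setDP[vy _].
  have ux : x \in succs V u by rewrite (subsetP (subset_succs u UV)) ?eu.
  suff: v \in succs V u by rewrite inE.
  by rewrite (subsetP (succs_sub bV ux)) // -eV (subsetP (subset_succs y UV)).
- exact: bip_rank_merge.
Qed.

Lemma bip_step U V :
    bipartitional U -> bipartitional V -> U \proper V ->
  exists W, [/\ bipartitional W, U \subset W, W \subset V
              & bip_rank W = (bip_rank U).+1].
Proof.
move=> bU bV ltUV.
have [/existsP[x /existsP[y /and3P[xN yB xyV]]]|noB] :=
  boolP [exists x, exists y,
    [&& x \notin succs U x, y \in plain_block U x & (x, y) \in V]].
  exact: bip_step_plain bU bV (proper_sub ltUV) xN yB xyV.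
apply: bip_step_underlined => // x y xN yB; apply: contra noB => xyV.
by apply/existsP; exists x; apply/existsP; exists y; rewrite xN yB.
Qed.

(** * Extreme values of the rank function and conclusion *)

Lemma bip_rank0 : 0 < #|X| -> bip_rank set0 = 1.
Proof.
case/card_gt0P=> x _.
have r0 : reflexives set0 = set0 by apply/setP=> z; rewrite !inE.
rewrite /bip_rank /underlined_rows /plain_rows r0 imset0 setC0 !cards0 muln0.
rewrite addn0 subn0; apply/eqP/cards1P; exists set0; apply/setP=> S.
have rows z : succs set0 z = set0 by apply/setP=> w; rewrite !inE.
apply/imsetP/set1P => [[z _ ->]|->]; first exact: rows.
by exists x; rewrite // rows.
Qed.

Lemma bip_rankT : 0 < #|X| -> bip_rank setT = 3 * #|X| - 1.
Proof.
case/card_gt0P=> x _.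
have rT : reflexives setT = setT by apply/setP=> z; rewrite !inE.
rewrite /bip_rank /underlined_rows /plain_rows rT setCT imset0 cards0 cardsT.
rewrite add0n; congr (_ - _); apply/eqP/cards1P; exists setT; apply/setP=> S.
have rows z : succs setT z = setT by apply/setP=> w; rewrite !inE.
apply/imsetP/set1P => [[z _ ->]|->]; first exact: rows.
by exists x; rewrite // rows.
Qed.

End Rows.

Theorem corollary5p3 (X : finType) (n : nat) (cardX : #|X| = n)
    (n_ge1 : 1 <= n) :
  graded (Bip X) /\ rank (Bip X) = 3 * n - 2.
Proof.
have step (U V : Bip X) : (U < V)%O -> exists W : Bip X,
    [/\ (U < W)%O, (W <= V)%O & bip_rank W = (bip_rank U).+1].
  rewrite lt_neqAle leEbip => /andP[neqUV leUV].
  have ltUV : U \proper V by rewrite properEneq leUV andbT.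
  have [W [bW UW WV rW]] := bip_step (valP U) (valP V) ltUV.
  exists (MkBip bW); split=> //; rewrite lt_neqAle leEbip UW andbT.
  by apply: contraPneq rW => -> /= /n_Sn.
have [gr ->] := graded_rank_function step; split=> //=.
(* The rank is (3n - 1) - 1. *)
by rewrite bip_rank0 ?bip_rankT ?cardX //; lia.
Qed.
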